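(* Let $\mathbf u_k$ and $\mathbf w_k$ be the approximate solution and the descent direction at the $k$-th iteration of the Exact Penalization Algorithm (preliminary version) described in the context; that is, $\mathbf w_k\in\mathbf H_0^1(\Omega)$ solves $$\langle(\mathcal J(\mathbf u_k)+\mathcal H(\mathbf u_k))\mathbf w_k,\mathbf v\rangle_{\mathbf H^{-1},\mathbf H_0^1}=-\langle\bar{\boldsymbol d}_k,\mathbf v\rangle_{\mathbf H^{-1},\mathbf H_0^1}\qquad\forall\,\mathbf v\in\mathbf H_0^1(\Omega),$$ where $\bar{\boldsymbol d}_k$ is the element of minimal $\mathbf H^{-1}$-norm of $\partial J_\sigma(\mathbf u_k)$. If $\operatorname{div}\mathbf u_k=0$, then $$\|\operatorname{div}\mathbf w_k\|_{L^2(\Omega)}^2\le\frac1\gamma\,\frac{\|\bar{\boldsymbol d}_k\|_{\mathbf H^{-1}}^2}{C}.$$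
   Context: $\Omega\subset\mathbb R^n$, $n\in\{2,3\}$, is open and bounded with Lipschitz boundary; $\mathbf H_0^1(\Omega)=(H_0^1(\Omega))^n$ with dual $\mathbf H^{-1}(\Omega)$. $\mathcal E\mathbf u$ is the symmetric gradient with entries $\frac12\left(\frac{\partial u_i}{\partial x_j}+\frac{\partial u_j}{\partial x_i}\right)$; $A:B=\mathrm{tr}(AB^\top)$, $|A|=\sqrt{A:A}$. Constants $\mu,g,\beta,\gamma,\sigma>0$ are fixed, and $\mathbf f$ is such that $\mathbf u\mapsto\int_\Omega\mathbf f\cdot\mathbf u\,dx$ is continuous and linear on $\mathbf H_0^1(\Omega)$. Define $J(\mathbf u)=\mu\int_\Omega|\mathcal E\mathbf u|^2dx+\int_\Omega\Psi(\mathcal E\mathbf u)\,dx-\int_\Omega\mathbf f\cdot\mathbf u\,dx$ with $\Psi(A)=g|A|-\frac{g^2}{2\beta}$ if $|A|\ge g/\beta$, $\Psi(A)=\frac\beta2|A|^2$ if $|A|<g/\beta$; and $J_\sigma(\mathbf u)=J(\mathbf u)+\sigma\|\operatorname{div}\mathbf u\|_{L^1(\Omega)}$, with convex subdifferential $\partial J_\sigma(\mathbf u)\subset\mathbf H^{-1}(\Omega)$. For $\mathbf u\in\mathbf H_0^1(\Omega)$ let $E_\beta=\{x\in\Omega:|\mathcal E\mathbf u(x)|<g/\beta\}$ and $A_\gamma=\{x\in\Omega:|\operatorname{div}\mathbf u(x)|<\sigma/\gamma\}$, and define $\mathcal J(\mathbf u),\mathcal H(\mathbf u):\mathbf H_0^1(\Omega)\to\mathbf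 H^{-1}(\Omega)$ by $$\langle\mathcal J(\mathbf u)\mathbf v,\mathbf w\rangle=2\mu\int_\Omega\mathcal E\mathbf v:\mathcal E\mathbf w\,dx+g\int_{\Omega\setminus E_\beta}\frac{\mathcal E\mathbf v:\mathcal E\mathbf w}{|\mathcal E\mathbf u|}dx-g\int_{\Omega\setminus E_\beta}\frac{(\mathcal E\mathbf u:\mathcal E\mathbf w)(\mathcal E\mathbf u:\mathcal E\mathbf v)}{|\mathcal E\mathbf u|^3}dx+\beta\int_{E_\beta}\mathcal E\mathbf v:\mathcal E\mathbf w\,dx,$$ $$\langle\mathcal H(\mathbf u)\mathbf v,\mathbf w\rangle=\sigma\int_{\Omega\setminus A_\gamma}\frac{\operatorname{div}\mathbf v\operatorname{div}\mathbf w}{|\operatorname{div}\mathbf u|}dx-\sigma\int_{\Omega\setminus A_\gamma}\frac{(\operatorname{div}\mathbf u\operatorname{div}\mathbf w)(\operatorname{div}\mathbf u\operatorname{div}\mathbf v)}{|\operatorname{div}\mathbf u|^3}dx+\gamma\int_{A_\gamma}\operatorname{div}\mathbf v\operatorname{div}\mathbf w\,dx.$$ $C>0$ denotes a constant (coming from Korn's inequality) such that $\langle\mathcal J(\mathbf u)\mathbf w,\mathbf w\rangle\ge C\|\mathbf w\|_{\mathbf H_0^1}^2$ for all $\mathbf u,\mathbf w\in\mathbf H_0^1(\Omega)$. Algorithm (preliminary version): start with $\mathbf u_0$ such that $\operatorname{div}\mathbf u_0=0$; at iteration $k$, compute $\bar{\boldsymbol d}_k=\operatorname{argmin}_{\boldsymbol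 d\in\partial J_\sigma(\mathbf u_k)}\|\boldsymbol d\|_{\mathbf H^{-1}}$, compute $\mathbf w_k$ from the linear system in the claim, choose a step length $\alpha_k$ by line search, and set $\mathbf u_{k+1}=\mathbf u_k+\alpha_k\mathbf w_k$. *)

(* Defs.v *)
From HB Require Import structures.
From mathcomp Require Import all_boot all_order all_algebra.
From mathcomp Require Import all_classical all_reals all_analysis.

Set Implicit Arguments.
Unset Strict Implicit.
Unset Printing Implicit Defensive.

Import Order.TTheory GRing.Theory Num.Theory.
Import numFieldNormedType.Exports.

Local Open Scope classical_set_scope.
Local Open Scope ring_scope.

(* R^n is ['rV[R]_n], with the sigma-algebra generated by the coordinates. *)
Section measurable_rV.
Context {R : realType} (n : nat).

Let coord (i : 'I_n) (x : 'rV[R]_n) : R := x 0 i.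

Let rV_set0 : g_sigma_preimage coord set0.
Proof. exact: sigma_algebra0. Qed.

Let rV_setC A : g_sigma_preimage coord A -> g_sigma_preimage coord (~` A).
Proof. exact: sigma_algebraC. Qed.

Let rV_bigcup (F : (set 'rV[R]_n)^nat) :
  (forall i, g_sigma_preimage coord (F i)) ->
  g_sigma_preimage coord (\bigcup_i (F i)).
Proof. exact: sigma_algebra_bigcup. Qed.

HB.instance Definition _ := @isMeasurable.Build default_measure_display
  'rV[R]_n (g_sigma_preimage coord) rV_set0 rV_setC rV_bigcup.

Lemma measurable_coord (i : 'I_n) :
  measurable_fun [set: 'rV[R]_n] (fun x : 'rV[R]_n => x 0 i).
Proof.
move=> _ Y mY; rewrite setTI; apply: sub_sigma_algebra => /=.
rewrite -bigcup_seq/=; exists i => /=; first by rewrite mem_index_enum.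
by exists Y => //; rewrite setTI.
Qed.

Lemma measurable_fun_rV d (T : measurableType d) (f : T -> 'rV[R]_n) :
  (forall i, measurable_fun [set: T] (fun t => f t 0 i)) ->
  measurable_fun [set: T] f.
Proof.
move=> mf _ A mA; rewrite setTI.
suff : g_sigma_preimage coord `<=` [set B | measurable (f @^-1` B)] by exact.
apply: smallest_sub.
  split=> [|B|F] /=; first by rewrite preimage_set0.
    by rewrite setTD preimage_setC => ?; exact: measurableC.
  by rewrite preimage_bigcup => ?; exact: bigcup_measurable.
rewrite -bigcup_seq; apply: bigcup_sub => i _ _ [B mB <-] /=.
by have := mf i measurableT _ mB; rewrite !setTI.
Qed.

End measurable_rV.

Section lebesgue_rV.
Context {R : realType}.

Definition rV_cons (n : nat) (p : 'rV[R]_n * R) : 'rV[R]_n.+1 :=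
  \row_i oapp (fun j => p.1 0 j) p.2 (unlift ord0 i).

Lemma measurable_rV_cons (n : nat) :
  measurable_fun [set: 'rV[R]_n * R] (@rV_cons n).
Proof.
apply: measurable_fun_rV => i; rewrite /rV_cons.
under eq_fun do rewrite mxE.
case: (unliftP ord0 i) => [j _|_] /=; last exact: measurable_snd.
by apply: (measurableT_comp (measurable_coord j)); exact: measurable_fst.
Qed.

Section lebesgue_cons.
Context (n : nat) (m : {measure set 'rV[R]_n -> \bar R}).

(* product of m with the one-dimensional Lebesgue measure, carried to R^(n+1) *)
Definition lebesgue_cons : set 'rV[R]_n.+1 -> \bar R :=
  pushforward (m \x (@lebesgue_measure R))%E (@rV_cons n).

Let lebesgue_cons0 : lebesgue_cons set0 = 0%E.
Proof. by rewrite /lebesgue_cons /pushforward preimage_set0 measure0. Qed.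

Let lebesgue_cons_ge0 A : (0 <= lebesgue_cons A)%E.
Proof. by rewrite /lebesgue_cons /pushforward; exact: measure_ge0. Qed.

Let lebesgue_cons_sigma_additive : semi_sigma_additive lebesgue_cons.
Proof.
move=> F mF tF mUF; rewrite /lebesgue_cons.
pose nu : {measure set _ -> \bar R} :=
  measure_function_pushforward__canonical__measure_function_Measure
    (m \x (@lebesgue_measure R))%E (@measurable_rV_cons n).
exact: (@measure_semi_sigma_additive _ _ _ nu).
Qed.

HB.instance Definition _ := isMeasure.Build _ _ _ lebesgue_cons
  lebesgue_cons0 lebesgue_cons_ge0 lebesgue_cons_sigma_additive.

End lebesgue_cons.

(* n-fold product of the one-dimensional Lebesgue measure *)
Fixpoint lebesgue_rV (n : nat) : {measure set 'rV[R]_n -> \bar R} :=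
  match n with
  | 0 => \d_(0 : 'rV[R]_0)
  | m.+1 => lebesgue_cons (lebesgue_rV m)
  end.

End lebesgue_rV.

Section lipschitz_domain.
Context {R : realType} (n : nat).

(* After an orthogonal change of coordinates, near each boundary point [Omega]
   is the strict epigraph of a Lipschitz function of n - 1 coordinates. *)
Definition lipschitz_boundary (Omega : set 'rV[R]_n) : Prop :=
  forall p : 'rV[R]_n, closure Omega p -> ~ interior Omega p ->
  exists (Q : 'M[R]_n) (i : 'I_n) (h : 'rV[R]_n.-1 -> R^o) (r : R),
    [/\ Q *m Q^T = 1%:M, lipschitz h, 0 < r &
      forall x, ball p r x ->
        (Omega x <-> h (col' i (x *m Q)) < (x *m Q) 0 i)].

End lipschitz_domain.

Section sobolev.
Context {R : realType} (n : nat) (Omega : set 'rV[R]_n).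
Implicit Types (u v : 'rV[R]_n -> 'rV[R]_n) (G : 'rV[R]_n -> 'M[R]_n).

Notation mu := (@lebesgue_rV R n).

Definition partial (j : 'I_n) (phi : 'rV[R]_n -> R) : 'rV[R]_n -> R :=
  'D_(delta_mx 0 j : 'rV[R]_n) (phi : 'rV[R]_n -> R^o).

Fixpoint Ck (k : nat) (phi : 'rV[R]_n -> R) : Prop :=
  if k is m.+1 then
    continuous phi /\
    forall j : 'I_n,
      (forall x, derivable (phi : _ -> R^o) x (delta_mx 0 j : 'rV[R]_n)) /\
      Ck m (partial j phi)
  else continuous phi.

(* C_c^oo(Omega) *)
Definition test_function (phi : 'rV[R]_n -> R) : Prop :=
  [/\ forall k, Ck k phi,
      compact (closure [set x | phi x != 0]) &
      closure [set x | phi x != 0] `<=` Omega].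

Definition L2 (h : 'rV[R]_n -> R) : Prop :=
  measurable_fun Omega h /\ (\int[mu]_(x in Omega) (h x ^+ 2)%:E < +oo)%E.

Definition L1norm (h : 'rV[R]_n -> R) : R := \int[mu]_(x in Omega) `|h x|.

Definition L2norm (h : 'rV[R]_n -> R) : R :=
  Num.sqrt (\int[mu]_(x in Omega) (h x ^+ 2)).

Definition dotmx m p (A B : 'M[R]_(m, p)) : R := \tr (A *m B^T).

Definition normF m p (A : 'M[R]_(m, p)) : R := Num.sqrt (dotmx A A).

(* [u] is in H^1(Omega)^n, with distributional gradient G_ij = d u_i / d x_j *)
Definition H1_gradient u G : Prop :=
  [/\ forall i, L2 (fun x => u x 0 i),
      forall i j, L2 (fun x => G x i j) &
      forall phi, test_function phi -> forall i j,
        \int[mu]_(x in Omega) (u x 0 i * partial j phi x) =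
        - \int[mu]_(x in Omega) (G x i j * phi x)].

Definition jacobian_mx u : 'rV[R]_n -> 'M[R]_n :=
  fun x => \matrix_(i, j) partial j (fun y => u y 0 i) x.

(* closure of C_c^oo(Omega)^n in H^1(Omega)^n; functions are representatives of
   their class modulo a.e. equality on Omega, values off Omega are irrelevant *)
Definition H01 u : Prop :=
  exists2 G, H1_gradient u G &
    forall e : R, 0 < e ->
    exists2 phi : 'rV[R]_n -> 'rV[R]_n,
      forall i, test_function (fun x => phi x 0 i) &
      (\int[mu]_(x in Omega)
         (normF (u x - phi x) ^+ 2 + normF (G x - jacobian_mx phi x) ^+ 2)%:E
       < e%:E)%E.

(* unique up to null sets on H^1(Omega)^n *)
Definition grad u : 'rV[R]_n -> 'M[R]_n :=
  xget (fun=> 0) [set G | H1_gradient u G].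

Definition symgrad u (x : 'rV[R]_n) : 'M[R]_n :=
  2^-1 *: (grad u x + (grad u x)^T).

Definition div u (x : 'rV[R]_n) : R := \tr (grad u x).

Definition div_free u : Prop := div u = cst 0 %[ae mu in Omega].

(* the gradient norm; by Poincare's inequality it is equivalent on H_0^1 to the
   full H^1 norm, Omega being bounded *)
Definition norm_H01 u : R := L2norm (fun x => normF (grad u x)).

(* H^{-1}(Omega)^n; values off [H01] are irrelevant *)
Definition Hm1 (l : ('rV[R]_n -> 'rV[R]_n) -> R) : Prop :=
  (forall (a : R) u v, H01 u -> H01 v -> l (a *: u + v) = a * l u + l v) /\
  exists M : R, forall v, H01 v -> `|l v| <= M * norm_H01 v.

Definition norm_Hm1 (l : ('rV[R]_n -> 'rV[R]_n) -> R) : R :=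
  sup [set `|l v| / norm_H01 v | v in [set v | H01 v /\ norm_H01 v != 0]].

End sobolev.

Section bingham.
Context {R : realType} (n : nat) (Omega : set 'rV[R]_n).
Variables (mu g beta gamma sigma : R) (f : 'rV[R]_n -> 'rV[R]_n).
Implicit Types (u v w : 'rV[R]_n -> 'rV[R]_n).
Implicit Types (d : ('rV[R]_n -> 'rV[R]_n) -> R).

Notation leb := (@lebesgue_rV R n).
Notation E u := (symgrad Omega u).
Notation div u := (div Omega u).

Definition force u : R := \int[leb]_(x in Omega) dotmx (f x) (u x).

Definition admissible_force : Prop :=
  [/\ forall i, measurable_fun Omega (fun x => f x 0 i),
      forall u, H01 Omega u ->
        leb.-integrable Omega (fun x => (dotmx (f x) (u x))%:E) &
      Hm1 Omega force].

Definition Psi (A : 'M[R]_n) : R :=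
  if g / beta <= normF A then g * normF A - g ^+ 2 / (2 * beta)
  else beta / 2 * normF A ^+ 2.

Definition J u : R :=
  mu * (\int[leb]_(x in Omega) (normF (E u x) ^+ 2))
  + \int[leb]_(x in Omega) Psi (E u x) - force u.

Definition Jsigma u : R := J u + sigma * L1norm Omega (div u).

Definition subdiff u d : Prop :=
  [/\ H01 Omega u, Hm1 Omega d &
      forall v, H01 Omega v -> Jsigma u + d (v - u) <= Jsigma v].

Definition E_beta u : set 'rV[R]_n :=
  [set x | Omega x /\ normF (E u x) < g / beta].

Definition A_gamma u : set 'rV[R]_n :=
  [set x | Omega x /\ `|div u x| < sigma / gamma].

Definition opJ u v : ('rV[R]_n -> 'rV[R]_n) -> R := fun w =>
  2 * mu * (\int[leb]_(x in Omega) dotmx (E v x) (E w x))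
  + g * (\int[leb]_(x in Omega `\` E_beta u)
           (dotmx (E v x) (E w x) / normF (E u x)))
  - g * (\int[leb]_(x in Omega `\` E_beta u)
           (dotmx (E u x) (E w x) * dotmx (E u x) (E v x)
            / normF (E u x) ^+ 3))
  + beta * (\int[leb]_(x in E_beta u) dotmx (E v x) (E w x)).

Definition opH u v : ('rV[R]_n -> 'rV[R]_n) -> R := fun w =>
  sigma * (\int[leb]_(x in Omega `\` A_gamma u)
             (div v x * div w x / `|div u x|))
  - sigma * (\int[leb]_(x in Omega `\` A_gamma u)
               ((div u x * div w x) * (div u x * div v x)
                / `|div u x| ^+ 3))
  + gamma * (\int[leb]_(x in A_gamma u) (div v x * div w x)).

Definition min_norm_subgradient u d : Prop :=
  subdiff u d /\
  forall d', subdiff u d' -> norm_Hm1 Omega d <= norm_Hm1 Omega d'.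

Definition descent_direction u d w : Prop :=
  H01 Omega w /\
  forall v, H01 Omega v -> opJ u w v + opH u w v = - d v.

(* Iterations 0, ..., k. The line search is not specified, so the step lengths
   [alpha] are arbitrary reals. *)
Record exact_penalization (k : nat)
    (u : nat -> 'rV[R]_n -> 'rV[R]_n)
    (d : nat -> ('rV[R]_n -> 'rV[R]_n) -> R)
    (w : nat -> 'rV[R]_n -> 'rV[R]_n) (alpha : nat -> R) : Prop := {
  ep_init : H01 Omega (u 0) /\ div_free Omega (u 0);
  ep_subgradient :
    forall j, (j <= k)%N -> min_norm_subgradient (u j) (d j);
  ep_direction :
    forall j, (j <= k)%N -> descent_direction (u j) (d j) (w j);
  ep_update : forall j, (j < k)%N ->
    u j.+1 = u j + alpha j *: w j %[ae leb in Omega]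
}.

End bingham.

(* Main.v *)
(* Test the equation for w_k with v = w_k. As div u_k = 0 almost everywhere, the
   set where |div u_k| >= sigma / gamma is null, so that H(u_k) contributes
   exactly gamma ||div w_k||^2. With S = ||d_k|| and N = ||w_k|| this leaves
   gamma ||div w_k||^2 <= S N - C N^2 <= S^2 / (4 C). *)
Require Import Defs.
From HB Require Import structures.
From mathcomp Require Import all_boot all_order all_algebra.
From mathcomp Require Import all_classical all_reals all_analysis.
From mathcomp Require Import measurable_realfun lra.

Import Order.TTheory GRing.Theory Num.Theory.
Import numFieldNormedType.Exports.

Local Open Scope classical_set_scope.
Local Open Scope ring_scope.

Section integral_ae.
Local Open Scope ereal_scope.
Context d (T : measurableType d) (R : realType).
Context (mu : {measure set T -> \bar R}).
Implicit Types (f g : T -> \bar R) (D E : set T).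
Import HBNNSimple.

(* A simple function below [f] lies below [g] once it is cut off on a null set. *)
Lemma ge0_ae_le_integral f g : (forall x, 0 <= f x) -> (forall x, 0 <= g x) ->
  (\forall x \ae mu, f x <= g x) -> \int[mu]_x f x <= \int[mu]_x g x.
Proof.
move=> f0 g0 [N [mN N0 fgN]]; rewrite !ge0_integralTE//=.
apply/ge_ereal_sup => /= _ [h /= hf <-].
have [p pE] : exists p : {nnsfun T >-> R}, p =1 h \_ (~` N).
  by exists (proj_nnsfun h (measurableC mN)) => x; rewrite -mrestrict.
apply: ereal_sup_ubound => /=; exists p.
  move=> x; rewrite pE patchE; case: ifPn => // xN.
  apply: (le_trans (hf x)); apply: contrapT => fgx.
  by move: xN; rewrite inE; apply; exact: fgN.
(* Only the simple functions [h] and [p], which are measurable, are compared here; [f] and [g]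
   themselves may be arbitrary. *)
rewrite -!integralT_nnsfun; apply: ge0_ae_eq_integral => //.
- exact/measurable_EFinP.
- exact/measurable_EFinP.
- by move=> x _; rewrite lee_fin.
- by move=> x _; rewrite lee_fin.
- exists N; split => // x /= hx; apply: contrapT => Nx; apply: hx => _.
  by rewrite pE patchE mem_set.
Qed.

(** Extension by zero turns a change of domain by a null set into an a.e. equality of integrands on
    the whole space. Positive and negative parts are then compared by two opposite inequalities, so
    [A_gamma] and [div] can be treated without a measurability proof. *)
Lemma ae_eq_restrict_integral D E f g :
  (\forall x \ae mu, (f \_ D) x = (g \_ E) x) ->
  \int[mu]_(x in D) f x = \int[mu]_(x in E) g x.
Proof.
have le_int (f1 g1 : T -> \bar R) : (forall x, 0 <= f1 x) ->
    (forall x, 0 <= g1 x) -> (\forall x \ae mu, f1 x = g1 x) ->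
    \int[mu]_x f1 x = \int[mu]_x g1 x.
  move=> f0 g0 fg; apply/eqP; rewrite eq_le; apply/andP.
  by split; apply: ge0_ae_le_integral => //; apply: filterS fg => x ->.
move=> fg; rewrite integral_mkcond [RHS]integral_mkcond.
rewrite integralE [RHS]integralE.
congr (_ - _); apply: le_int => //; apply: filterS fg => x.
- by rewrite !funeposE => ->.
- by rewrite !funenegE => ->.
Qed.

Lemma ae_eq_restrict_Rintegral D E (f g : T -> R) :
  (\forall x \ae mu, (f \_ D) x = (g \_ E) x) ->
  (\int[mu]_(x in D) f x = \int[mu]_(x in E) g x)%R.
Proof.
move=> fg; congr fine; apply: ae_eq_restrict_integral.
apply: filterS fg => x fgx.
by rewrite !restrict_EFin /= fgx.
Qed.

End integral_ae.

Section bingham_theory.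
Context {R : realType} (n : nat) (Omega : set 'rV[R]_n).
Implicit Types (u w : 'rV[R]_n -> 'rV[R]_n).

Lemma L2norm_sqr (h : 'rV[R]_n -> R) :
  L2norm Omega h ^+ 2 = \int[@lebesgue_rV R n]_(x in Omega) (h x ^+ 2).
Proof. by rewrite sqr_sqrtr// Rintegral_ge0// => x _; exact: sqr_ge0. Qed.

Lemma opH_div_free (gamma sigma : R) u w :
  0 < gamma -> 0 < sigma -> div_free Omega u ->
  opH Omega gamma sigma u w w = gamma * L2norm Omega (div Omega w) ^+ 2.
Proof.
move=> gamma0 sigma0 divu0; have sg0 : 0 < sigma / gamma by rewrite divr_gt0.
pose nu := @lebesgue_rV R n.
have AE : \forall x \ae nu, (x \in A_gamma Omega gamma sigma u) = (x \in Omega).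
  apply: filterS divu0 => x Du.
  apply/idP/idP; rewrite !inE; first by case.
  by move=> Ox; split => //; rewrite Du//= normr0.
(* As [F] is arbitrary, this disposes of both quotients by powers of |div u| with no estimate of
   them. *)
have DE F : \int[nu]_(x in Omega `\` A_gamma Omega gamma sigma u) F x = 0.
  rewrite (@ae_eq_restrict_Rintegral _ _ _ nu _ set0 _ F).
    by rewrite /Rintegral integral_set0.
  apply: filterS AE => x AEx.
  by rewrite !patchE in_set0 in_setD AEx andbN.
rewrite /opH !DE !mulr0 subr0 add0r L2norm_sqr; congr (_ * _).
apply: ae_eq_restrict_Rintegral; apply: filterS AE => x AEx.
by rewrite !patchE AEx -expr2.
Qed.

Lemma Hm1_le_norm (l : ('rV[R]_n -> 'rV[R]_n) -> R) w :
  Hm1 Omega l -> H01 Omega w -> `|l w| <= norm_Hm1 Omega l * norm_H01 Omega w.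
Proof.
move=> [_ [M lM]] Hw; have N0 v : 0 <= norm_H01 Omega v by exact: sqrtr_ge0.
(* The supremum in [norm_Hm1] skips vectors of norm zero; on these the continuity bound [M] forces
   [l w] to vanish. *)
have [Nw0|Nw0] := eqVneq (norm_H01 Omega w) 0.
  by have := lM _ Hw; rewrite Nw0 !mulr0.
rewrite -ler_pdivrMr ?lt0r ?Nw0 ?N0//; apply: ub_le_sup; last by exists w.
(* A real [sup] dominates its set only if the set is bounded above; [M] is such a bound. *)
exists M => _ [v [Hv Nv0] <-].
by rewrite ler_pdivrMr ?lt0r ?Nv0 ?N0//; exact: lM.
Qed.

End bingham_theory.

Theorem theorem3 (R : realType) (n : nat) (hn : n = 2%N \/ n = 3%N)
    (Omega : set 'rV[R]_n)
    (Omega_open : open Omega) (Omega_bounded : bounded_set Omega)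
    (Omega_lipschitz : lipschitz_boundary Omega)
    (mu g beta gamma sigma : R)
    (mu0 : 0 < mu) (g0 : 0 < g) (beta0 : 0 < beta) (gamma0 : 0 < gamma)
    (sigma0 : 0 < sigma)
    (f : 'rV[R]_n -> 'rV[R]_n) (hf : admissible_force Omega f)
    (C : R) (C0 : 0 < C)
    (hC : forall u w : 'rV[R]_n -> 'rV[R]_n, H01 Omega u -> H01 Omega w ->
      C * norm_H01 Omega w ^+ 2 <= opJ Omega mu g beta u w w)
    (u : nat -> 'rV[R]_n -> 'rV[R]_n)
    (d : nat -> ('rV[R]_n -> 'rV[R]_n) -> R)
    (w : nat -> 'rV[R]_n -> 'rV[R]_n) (alpha : nat -> R) (k : nat)
    (run : exact_penalization Omega mu g beta gamma sigma f k u d w alpha)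
    (div_uk : div_free Omega (u k)) :
  L2norm Omega (div Omega (w k)) ^+ 2 <=
    gamma^-1 * (norm_Hm1 Omega (d k) ^+ 2 / C).
Proof.
have [[_ dHm1 _] _] := ep_subgradient run (leqnn k).
have [Hw /(_ _ Hw)] := ep_direction run (leqnn k).
(* Membership of [u k] in [H01] is read off the subgradient condition, which includes it. *)
have [Hu _ _] := (ep_subgradient run (leqnn k)).1.
rewrite opH_div_free// => eqd.
have leJ := hC _ _ Hu Hw.
have led := Hm1_le_norm _ _ _ _ dHm1 Hw.
have := ler_norm (- d k (w k)); rewrite normrN => le_d.
set D := L2norm _ _ in eqd *; set N := norm_H01 _ _ in leJ led.
set S := norm_Hm1 _ _ in led *.
rewrite ler_pdivlMl// ler_pdivlMr//.
have : gamma * D ^+ 2 <= S * N - C * N ^+ 2 by lra.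
rewrite -(ler_pM2r C0) => /le_trans; apply.
(* Completing the square: C (S N - C N^2) = S^2 / 4 - (C N - S / 2)^2, and S^2 / 4 <= S^2. *)
have : 0 <= (C * N - S / 2) ^+ 2 by exact: sqr_ge0.
have : 0 <= S ^+ 2 by exact: sqr_ge0.
by lra.
Qed.
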